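(* Let $\mathbf q^*=(q^*_{m,l},m\in\mathcal M,l\in\mathbb N_0)$ be the unique fixed point (in $\mathcal S$) of the system of ODEs (ODE) given in the context. Then, for all $m\in\mathcal M$, the sequence $\{q^*_{m,l},l\in\mathbb N_0\}$ decreases doubly exponentially, i.e., there exist constants $l_m\in\mathbb N_0$, $a_m\in(0,1)$ and $b_m>0$ such that for all $l\ge l_m$, $$q^*_{m,l}\le b_m\,a_m^{d^l}.$$
   Context: Parameters: integers $K,M\ge1$, $d\ge2$; $\mathcal K=\{1,\dots,K\}$, $\mathcal M=\{1,\dots,M\}$; constants $\lambda,\xi,u_m>0$; $w_k\in(0,1)$ with $\sum_kw_k=1$; $v_m\in(0,1)$ with $\sum_mv_m=1$; $\lambda\xi<\sum_mu_mv_m$. $\mathbb N_0=\mathbb N\cup\{0\}$. $\mathcal S=\{\mathbf q\in[0,1]^{M\times\mathbb N_0}:q_{m,0}=1,\ q_{m,l}\ge q_{m,l+1},\ \sum_{l}q_{m,l}<\infty\ \forall m,l\}$. Underlying graph sequence: for each $N$, $G^N=(W^N,V^N,E^N)$ is a bipartite graph with $W^N=\{1,\dots,W(N)\}$ (dispatchers), $V^N=\{1,\dots,N\}$ (servers), $E^N\subseteq W^N\times V^N$, $W(N)/N\to\xi$; $W^N$ is partitioned into types $W^N_k$ with $|W^N_k|/W(N)\to w_k$; $V^N$ into types $V^N_m$ with $|V^N_m|/N\to v_m$. Let $\mathcal N^N_w(i)=\{j:(i,j)\in E^N\}$, $\delta^N_i=|\mathcal N^N_w(i)|$, $\deg^N_w(i,m)=|\{j\in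 V^N_m:(i,j)\in E^N\}|$, $\deg^N_v(k,j)=|\{i\in W^N_k:(i,j)\in E^N\}|$. Standing assumption 1 (Condition C): (a) for each $k,m$, $\lim_N|\{(i,j)\in W^N_k\times V^N_m:(i,j)\in E^N\}|/(|W^N_k||V^N_m|)=p_{k,m}\in[0,1]$; (b) for each $k,m$, $\frac{\max_{i\in W^N_k}\deg^N_w(i,m)}{\min_{i\in W^N_k}\deg^N_w(i,m)}\to1$ and $\frac{\max_{j\in V^N_m}\deg^N_v(k,j)}{\min_{j\in V^N_m}\deg^N_v(k,j)}\to1$. Put $\delta_k=\sum_mp_{k,m}v_m>0$. Standing assumption 2 (subcritical regime): $\rho^N\to\rho$ for some $\rho<1$, where $$\rho^N=\max_{\emptyset\ne U\subseteq V^N}\Big(\sum_{m\in\mathcal M}u_m|U\cap V^N_m|\Big)^{-1}\sum_{i\in W^N}\Big(\mathbf 1_{(\delta^N_i\ge d)}\lambda\frac{\binom{|U\cap\mathcal N^N_w(i)|}{d}}{\binom{\delta^N_i}{d}}+\mathbf 1_{(\delta^N_i<d)}\lambda\frac{|U\cap\mathcal N^N_w(i)|}{\delta^N_i}\Big).$$ (ODE): for all $m\in\mathcal M$, $q_{m,0}(t)=1$ and for all $l\in\mathbb N$, $$\frac{dq_{m,l}(t)}{dt}=-u_m\big(q_{m,l}(t)-q_{m,l+1}(t)\big)+\lambda\xi\big(q_{m,l-1}(t)-q_{m,l}(t)\big)\sum_{k\in\mathcal K}\frac{p_{k,m}w_k}{\delta_k}\,\frac{(\tilde q_{k,l-1}(t))^d-(\tilde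 q_{k,l}(t))^d}{\tilde q_{k,l-1}(t)-\tilde q_{k,l}(t)},$$ with $\tilde q_{k,l}=\sum_{m}\frac{v_mp_{k,m}}{\delta_k}q_{m,l}$; $\frac{a^d-b^d}{a-b}$ is read as $\sum_{r=0}^{d-1}a^rb^{d-1-r}$ (also when $a=b$). A fixed point is a $\mathbf q^*$ with $q^*_{m,0}=1$ at which all right-hand sides vanish. *)

(* Defs.v *)
From mathcomp Require Import all_boot all_order all_algebra.
From mathcomp Require Import all_classical all_reals all_analysis.

Set Implicit Arguments.
Unset Strict Implicit.
Unset Printing Implicit Defensive.

Import Order.TTheory GRing.Theory Num.Theory.
Import numFieldNormedType.Exports.

Local Open Scope classical_set_scope.
Local Open Scope ring_scope.

(* The partition of the dispatchers (resp. servers) into K (resp. M) types is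
   given by the function mapping a vertex to its type, so classes may be empty;
   the limits of the class proportions make them nonempty for large N. *)
Record typed_bigraph (K M N : nat) := TypedBigraph {
  ndisp : nat;
  wtype : 'I_ndisp -> 'I_K;
  vtype : 'I_N -> 'I_M;
  edge : 'I_ndisp -> 'I_N -> bool }.

Section Graph.
Context (K M N : nat) (G : typed_bigraph K M N).

Definition wclass (k : 'I_K) : {set 'I_(ndisp G)} := [set i | wtype i == k]%SET.

Definition vclass (m : 'I_M) : {set 'I_N} := [set j | vtype G j == m]%SET.

Definition nbr (i : 'I_(ndisp G)) : {set 'I_N} := [set j | edge i j]%SET.

Definition wdeg (i : 'I_(ndisp G)) (m : 'I_M) : nat :=
  #|[set j in vclass m | edge i j]%SET|.

Definition vdeg (k : 'I_K) (j : 'I_N) : nat :=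
  #|[set i in wclass k | edge i j]%SET|.

Definition nedges (k : 'I_K) (m : 'I_M) : nat :=
  #|[set e : 'I_(ndisp G) * 'I_N |
      [&& e.1 \in wclass k, e.2 \in vclass m & edge e.1 e.2]]%SET|.

(* The default values of the minima, N and ndisp G, are upper bounds of the
   degrees, so they matter only when the type class is empty. *)
Definition max_wdeg (k : 'I_K) (m : 'I_M) : nat :=
  (\max_(i in wclass k) wdeg i m)%N.

Definition min_wdeg (k : 'I_K) (m : 'I_M) : nat :=
  \big[minn/N]_(i in wclass k) wdeg i m.

Definition max_vdeg (k : 'I_K) (m : 'I_M) : nat :=
  (\max_(j in vclass m) vdeg k j)%N.

Definition min_vdeg (k : 'I_K) (m : 'I_M) : nat :=
  \big[minn/ndisp G]_(j in vclass m) vdeg k j.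

End Graph.

(* Ratio a / b with 0 / 0 = 1, so that two types with no edge between them
   (max = min = 0) are allowed.  When b = 0 < a the value is 0, hence a sequence
   of such ratios tending to 1 has b > 0 or a = b = 0 eventually. *)
Definition deg_ratio (R : realType) (a b : nat) : R :=
  if (a == 0%N) && (b == 0%N) then 1 else a%:R / b%:R.

Definition condition_C (R : realType) (K M : nat)
    (G : forall N, typed_bigraph K M N) (p : 'I_K -> 'I_M -> R) : Prop :=
  [/\ forall k m,
        (fun N => (nedges (G N) k m)%:R
                  / (#|wclass (G N) k|%:R * #|vclass (G N) m|%:R) : R)
          @ \oo --> p k m,
      forall k m,
        (fun N => deg_ratio R (max_wdeg (G N) k m) (min_wdeg (G N) k m))
          @ \oo --> (1 : R)
    & forall k m,
        (fun N => deg_ratio R (max_vdeg (G N) k m) (min_vdeg (G N) k m))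
          @ \oo --> (1 : R)].

Section Load.
Context (R : realType) (K M N : nat) (G : typed_bigraph K M N).
Context (d : nat) (lambda : R) (u : 'I_M -> R).

Definition load_of (U : {set 'I_N}) : R :=
  (\sum_(m < M) u m * #|U :&: vclass G m|%:R)^-1 *
  \sum_(i < ndisp G)
    (if (d <= #|nbr i|)%N
     then lambda * ('C(#|U :&: nbr i|, d)%:R / 'C(#|nbr i|, d)%:R)
     else lambda * (#|U :&: nbr i|%:R / #|nbr i|%:R)).

(* For lambda, u > 0 all the loads are nonnegative, so the default value 0 does
   not change the maximum when N > 0. *)
Definition max_load : R :=
  \big[Num.max/0]_(U : {set 'I_N} | U != finset.set0) load_of U.

End Load.

Section MeanField.
Context (R : realType) (K M : nat).
Context (d : nat) (lambda xi : R) (u v : 'I_M -> R) (w : 'I_K -> R).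
Context (p : 'I_K -> 'I_M -> R).

Definition delta (k : 'I_K) : R := \sum_(m < M) p k m * v m.

Definition state_space : set ('I_M -> nat -> R) :=
  [set q : 'I_M -> nat -> R | [/\ forall m l, 0 <= q m l <= 1,
               forall m, q m 0%N = 1,
               forall m l, q m l.+1 <= q m l
             & forall m, cvgn (series (q m : R^nat))]].

Definition qtilde (q : 'I_M -> nat -> R) (k : 'I_K) (l : nat) : R :=
  \sum_(m < M) v m * p k m / delta k * q m l.

(* (a ^+ d - b ^+ d) / (a - b), extended by continuity to a = b. *)
Definition diff_quot_exp (a b : R) : R :=
  \sum_(r < d) a ^+ r * b ^+ (d.-1 - r).

(* Right-hand side of the equation for q_{m,l}; meaningful for 0 < l. *)
Definition ode_rhs (q : 'I_M -> nat -> R) (m : 'I_M) (l : nat) : R :=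
  - u m * (q m l - q m l.+1) +
  lambda * xi * (q m l.-1 - q m l) *
    \sum_(k < K) p k m * w k / delta k *
      diff_quot_exp (qtilde q k l.-1) (qtilde q k l).

Definition fixed_point (q : 'I_M -> nat -> R) : Prop :=
  (forall m, q m 0%N = 1) /\ (forall m l, (0 < l)%N -> ode_rhs q m l = 0).

End MeanField.

(* Main.v *)
Require Import Defs.
From mathcomp Require Import all_boot all_order all_algebra.
From mathcomp Require Import all_classical all_reals all_analysis.
From mathcomp Require Import ring lra.

Set Implicit Arguments.
Unset Strict Implicit.
Unset Printing Implicit Defensive.

Import Order.TTheory GRing.Theory Num.Theory.
Import numFieldNormedType.Exports.

Local Open Scope classical_set_scope.
Local Open Scope ring_scope.


(** Weighting the equation for q_{m,l} by v_m and summing over m collapses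
    both of its terms into differences in l: the service term because u_m is
    constant in l, and the arrival term because the weights v_m p_{k,m} /
    delta_k are exactly those of qtilde, so that the differences of the q_{m,l}
    add up to the denominator of the divided difference of x^d
    ([sum_ode_rhs]).  At a fixed point the total rate
    s_l = sum_m v_m u_m q_{m,l} at which servers with at least l tasks work and
    the rate a_l = lambda xi sum_k w_k qtilde_{k,l}^d of arrivals sent to
    servers with at least l tasks therefore satisfy
    s_{l+1} - a_l = s_{l+2} - a_{l+1}.  Summability of l |-> q_{m,l} makes both
    rates vanish at infinity, so the constant is 0 and s_{l+1} = a_l
    ([service_rate_eq_arrival_rate]).

    Each qtilde_{k,l} is bounded by a multiple of s_l, hence
    s_{l+1} <= B s_l^d for some constant B.  A sequence tending to 0 that obeys
    such a recursion with d >= 2 decreases doubly exponentially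
    ([doubly_exponential_decay]), and v_m u_m q_{m,l} <= s_l transfers the bound
    to every q_{m,l}. *)

Lemma mul_diff_quot_exp (R : realType) (d : nat) (a b : R) :
  (a - b) * diff_quot_exp d a b = a ^+ d - b ^+ d.
Proof.
rewrite -(opprB (b ^+ d)) subrXX -mulNr opprB; congr (_ * _).
by apply: eq_bigr => r _; rewrite mulrC.
Qed.

(** Rescaling by a constant C >= max 1 B absorbs the factor of the recursion:
    y = C x satisfies y_{l+1} <= y_l^d, because C B <= C^2 <= C^d.  Once
    y_{l0} <= 1/e, iterating gives y_{l0+n} <= (1/e)^(d^n). *)
Lemma doubly_exponential_decay (R : realType) (d : nat) (x : nat -> R) (B : R) :
  (2 <= d)%N -> (forall l, 0 <= x l) -> (forall l, x l.+1 <= B * x l ^+ d) ->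
  x @ \oo --> (0 : R) ->
  exists (l0 : nat) (a b : R),
    [/\ 0 < a < 1, 0 < b &
        forall l : nat, (l0 <= l)%N -> x l <= b * a ^+ (d ^ l)].
Proof.
move=> d_ge2 x_ge0 x_rec x_lim.
pose C : R := 1 + `|B|.
have C_ge1 : 1 <= C by rewrite lerDl.
have C_gt0 : 0 < C := lt_le_trans ltr01 C_ge1.
have step l : C * x l.+1 <= (C * x l) ^+ d.
  rewrite exprMn; apply: (@le_trans _ _ (C ^+ 2 * x l ^+ d)).
    rewrite expr2 -mulrA ler_pM2l//; apply: le_trans (x_rec l) _.
    by rewrite ler_wpM2r ?exprn_ge0// /C ler_wpDl// ler_norm.
  by rewrite ler_wpM2r ?exprn_ge0// ler_weXn2l.
have [l0 small] : exists l0, C * x l0 <= expR (- 1).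
  have small_gt0 : 0 < expR (- 1) / C :> R by rewrite divr_gt0 ?expR_gt0.
  have [l0 _ /(_ l0 (leqnn l0))/= small] := cvgr0_norm_le _ x_lim _ small_gt0.
  exists l0; rewrite mulrC -ler_pdivlMr//.
  exact: le_trans (ler_norm _) small.
have dl0_gt0 : (0 < d ^ l0)%N by rewrite expn_gt0 (ltn_trans _ d_ge2).
(* The d^l0-th root of 1/e turns (1/e)^(d^n) into a^(d^(l0+n)). *)
pose a : R := expR (- (d ^ l0)%:R^-1).
have a_pow : a ^+ (d ^ l0) = expR (- 1).
  by rewrite /a -expRM_natl mulrN mulfV// pnatr_eq0 -lt0n.
exists l0, a, C^-1; split.
- by rewrite expR_gt0 expR_lt1 oppr_lt0 invr_gt0 ltr0n.
- by rewrite invr_gt0.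
move=> l /subnKC <-; elim: (l - l0)%N => [|n IHn].
  by rewrite addn0 mulrC ler_pdivlMr// mulrC a_pow.
move: IHn; rewrite addnS !(mulrC C^-1) !ler_pdivlMr// !(mulrC _ C) => IHn.
apply: le_trans (step _) _.
rewrite expnSr exprM; apply: lerXn2r => //; rewrite nnegrE.
  by rewrite mulr_ge0// ltW.
by rewrite exprn_ge0// expR_ge0.
Qed.

Section FixedPoint.
Context (R : realType) (K M d : nat) (lambda xi : R) (u v : 'I_M -> R).
Context (w : 'I_K -> R) (p : 'I_K -> 'I_M -> R) (q : 'I_M -> nat -> R).

Definition service_rate (l : nat) : R := \sum_(m < M) v m * u m * q m l.

Definition arrival_rate (l : nat) : R :=
  lambda * xi * \sum_(k < K) w k * qtilde v p q k l ^+ d.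

Lemma qtilde_diff k l :
  \sum_(m < M) v m * p k m / delta v p k * (q m l - q m l.+1) =
  qtilde v p q k l - qtilde v p q k l.+1.
Proof. by rewrite /qtilde -sumrB; apply: eq_bigr => m _; rewrite mulrBr. Qed.

(** The prefactor q_{m,l} - q_{m,l+1} of the arrival term, averaged over m with
    the weights of qtilde_k, is the denominator of the divided difference, so
    only a difference of d-th powers remains. *)
Lemma sum_ode_rhs l :
  \sum_(m < M) v m * ode_rhs d lambda xi u v w p q m l.+1 =
  (arrival_rate l - arrival_rate l.+1)
  - (service_rate l.+1 - service_rate l.+2).
Proof.
rewrite /arrival_rate -mulrBr -sumrB.
under [in RHS]eq_bigr => k _ do
  rewrite -mulrBr -mul_diff_quot_exp -qtilde_diff mulr_suml mulr_sumr.
rewrite exchange_big mulr_sumr /service_rate -sumrB -sumrB.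
apply: eq_bigr => m _; rewrite /ode_rhs mulrDr addrC.
congr (_ + _); last by ring.
rewrite mulrCA -!mulrA; congr (_ * (_ * _)).
rewrite !mulr_sumr; apply: eq_bigr => k _ /=; ring.
Qed.

Context (q_S : state_space q).

Lemma state_space_cvg0 m : q m @ \oo --> (0 : R).
Proof. by case: q_S => _ _ _ q_sum; exact: cvg_series_cvg_0. Qed.

Lemma weighted_sum_cvg0 (c : 'I_M -> R) :
  (fun l => \sum_(m < M) c m * q m l) @ \oo --> (0 : R).
Proof.
have {2}<- : \sum_(m < M) c m * (0 : R) = 0.
  by rewrite big1// => m _; rewrite mulr0.
apply: (cvg_big (@add_continuous _)) => m _.
by apply: cvgMl_tmp; exact: state_space_cvg0.
Qed.

Lemma arrival_rate_cvg0 : (0 < d)%N -> arrival_rate @ \oo --> (0 : R).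
Proof.
move=> d_gt0.
have <- : lambda * xi * \sum_(k < K) w k * (0 : R) ^+ d = 0.
  by rewrite big1 ?mulr0// => k _; rewrite expr0n gtn_eqF// mulr0.
apply: cvgMl_tmp; apply: (cvg_big (@add_continuous _)) => k _.
apply: cvgMl_tmp; pose c m := v m * p k m / delta v p k.
exact: (cvg_comp _ _ (weighted_sum_cvg0 c) (@exprn_continuous R d 0)).
Qed.

(** Flow balance across each level l.  The fixed-point equations only say that
    the imbalance does not depend on l; it vanishes because no mass escapes to
    infinity for a state in the state space. *)
Lemma service_rate_eq_arrival_rate l :
  (0 < d)%N -> fixed_point d lambda xi u v w p q ->
  service_rate l.+1 = arrival_rate l.
Proof.
move=> d_gt0 [_ q_fix].
pose gap n := service_rate n.+1 - arrival_rate n.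
have gapS n : gap n.+1 = gap n.
  have := sum_ode_rhs n.
  rewrite big1 => [|m _]; last by rewrite q_fix ?mulr0.
  by rewrite /gap => e; lra.
have gap_cst n : gap (n + l)%N = gap l by elim: n => // n; rewrite addSn gapS.
have gap_lim : gap @ \oo --> (0 : R).
  rewrite -(subr0 0); apply: cvgB; last exact: arrival_rate_cvg0.
  have := weighted_sum_cvg0 (fun m => v m * u m).
  by rewrite -(cvg_shiftS service_rate).
have : (fun n => gap (n + l)%N) @ \oo --> (0 : R) by rewrite (cvg_shiftn l gap).
under eq_fun do rewrite gap_cst.
move=> /(cvg_unique _ (cvg_cst _)) gap0.
by apply/eqP; rewrite -subr_eq0; apply/eqP; apply: gap0.
Qed.

End FixedPoint.

Theorem theorem3p14 (R : realType) (K M d : nat)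
    (K_ge1 : (1 <= K)%N) (M_ge1 : (1 <= M)%N) (d_ge2 : (2 <= d)%N)
    (lambda xi : R) (u v : 'I_M -> R) (w : 'I_K -> R)
    (lambda_gt0 : 0 < lambda) (xi_gt0 : 0 < xi) (u_gt0 : forall m, 0 < u m)
    (w_01 : forall k, 0 < w k < 1) (w_sum : \sum_(k < K) w k = 1)
    (v_01 : forall m, 0 < v m < 1) (v_sum : \sum_(m < M) v m = 1)
    (stable : lambda * xi < \sum_(m < M) u m * v m)
    (G : forall N : nat, typed_bigraph K M N)
    (ndisp_lim : (fun N => (ndisp (G N))%:R / N%:R : R) @ \oo --> xi)
    (wclass_lim : forall k,
       (fun N => #|wclass (G N) k|%:R / (ndisp (G N))%:R : R) @ \oo --> w k)
    (vclass_lim : forall m,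
       (fun N => #|vclass (G N) m|%:R / N%:R : R) @ \oo --> v m)
    (p : 'I_K -> 'I_M -> R) (p_01 : forall k m, 0 <= p k m <= 1)
    (G_C : condition_C G p)
    (delta_gt0 : forall k, 0 < delta v p k)
    (rho : R) (rho_lt1 : rho < 1)
    (load_lim : (fun N => max_load (G N) d lambda u) @ \oo --> rho)
    (q : 'I_M -> nat -> R) (q_S : state_space q)
    (q_fix : fixed_point d lambda xi u v w p q) :
  forall m : 'I_M, exists (l_m : nat) (a_m b_m : R),
    [/\ 0 < a_m < 1, 0 < b_m &
        forall l : nat, (l_m <= l)%N -> q m l <= b_m * a_m ^+ (d ^ l)].
Proof.
have d_gt0 : (0 < d)%N := ltnW d_ge2.
have [q_01 _ _ _] := q_S.
have q_ge0 m l : 0 <= q m l by case/andP: (q_01 m l).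
have p_ge0 k m : 0 <= p k m by case/andP: (p_01 k m).
have v_gt0 m : 0 < v m by case/andP: (v_01 m).
have w_gt0 k : 0 < w k by case/andP: (w_01 k).
have vu_gt0 m : 0 < v m * u m by rewrite mulr_gt0.
pose s := service_rate u v q.
have s_ge0 l : 0 <= s l by apply: sumr_ge0 => m _; rewrite mulr_ge0// ltW.
have q_le_s m l : v m * u m * q m l <= s l.
  rewrite /s /service_rate (bigD1 m)//= lerDl.
  by apply: sumr_ge0 => i _; rewrite mulr_ge0// ltW.
(* Dividing by u_m converts the weights of qtilde_k into those of s, and each
   term of s is at most s. *)
pose c k := \sum_(m < M) p k m / delta v p k / u m.
have qt_ge0 k l : 0 <= qtilde v p q k l.
  apply: sumr_ge0 => m _; rewrite mulr_ge0// divr_ge0 ?(ltW (delta_gt0 k))//.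
  by rewrite mulr_ge0// ltW.
have qt_le k l : qtilde v p q k l <= c k * s l.
  rewrite /c mulr_suml; apply: ler_sum => m _.
  have -> : v m * p k m / delta v p k * q m l =
      p k m / delta v p k / u m * (v m * u m * q m l).
    by field; rewrite !gt_eqF.
  by rewrite ler_wpM2l// !divr_ge0 ?(ltW (u_gt0 m)) ?(ltW (delta_gt0 k)).
have s_rec l : s l.+1 <= lambda * xi * (\sum_(k < K) w k * c k ^+ d) * s l ^+ d.
  rewrite /s (service_rate_eq_arrival_rate q_S l d_gt0 q_fix) /arrival_rate.
  rewrite -[leRHS]mulrA ler_wpM2l ?mulr_ge0 ?(ltW lambda_gt0) ?(ltW xi_gt0)//.
  rewrite mulr_suml; apply: ler_sum => k _.
  rewrite -mulrA -exprMn ler_wpM2l ?(ltW (w_gt0 k))//.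
  by apply: lerXn2r (qt_le k l); rewrite nnegrE ?(le_trans _ (qt_le k l)).
have s_lim : s @ \oo --> (0 : R) by exact: weighted_sum_cvg0.
have [l0 [a [b [a_01 b_gt0 s_le]]]] :=
  doubly_exponential_decay d_ge2 s_ge0 s_rec s_lim.
move=> m; exists l0, a, (b / (v m * u m)); split => //.
  by rewrite divr_gt0.
move=> l l0_le_l; rewrite mulrAC ler_pdivlMr// mulrC.
exact: le_trans (q_le_s m l) (s_le l l0_le_l).
Qed.
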